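(* Let $U$ be a nonempty finite set. Any Boolean sublattice $\mathcal{B}$ of $\mathrm{Part}(U)$ is included in a Boolean sublattice $\mathcal{B}^{\ast}$ of $\mathrm{Part}(U)$ containing $\triangle$ and $\nabla$.
   Context: $\mathrm{Part}(U)$ is the lattice of all partitions of $U$ ordered by refinement; $\triangle$ is its least element (all blocks singletons) and $\nabla$ its greatest element (single block $U$). A Boolean sublattice of $\mathrm{Part}(U)$ is a sublattice (closed under meet and join of $\mathrm{Part}(U)$) that is itself a Boolean lattice with respect to its own least and greatest elements, which need not be $\triangle$ and $\nabla$. *)

(* Defs.v *)
From HB Require Import structures.
From mathcomp Require Import all_boot all_order.

Set Implicit Arguments.
Unset Strict Implicit.
Unset Printing Implicit Defensive.

Import Order.TTheory.
Local Open Scope order_scope.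

Record Part (U : finType) := MkPart {
  blocks :> {set {set U}};
  blocksP : partition blocks [set: U]
}.

HB.instance Definition _ (U : finType) := [isSub for @blocks U].
HB.instance Definition _ (U : finType) := [Finite of Part U by <:].

Section PartitionLattice.
Variable U : finType.
Implicit Types (P Q : Part U) (x y z : U) (R : rel U).

Definition same_block P : rel U := fun x y => y \in pblock P x.

Lemma same_block_equiv P : equivalence_rel (same_block P).
Proof.
by move=> x y z; apply: (pblock_equivalence (blocksP P)); rewrite inE.
Qed.

Lemma part_of_rel_subproof R : equivalence_rel R ->
  partition (equivalence_partition R [set: U]) [set: U].
Proof. by move=> eqR; apply: equivalence_partitionP => x y z _ _ _. Qed.

Definition part_of_rel R (eqR : equivalence_rel R) : Part U :=
  MkPart (part_of_rel_subproof eqR).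

Lemma same_block_part_of_rel R (eqR : equivalence_rel R) :
  same_block (part_of_rel eqR) =2 R.
Proof.
move=> x y; apply: pblock_equivalence_partition; rewrite ?inE //.
Qed.

Lemma same_block_inj P Q : same_block P =2 same_block Q -> P = Q.
Proof.
move=> eqPQ; apply: val_inj => /=.
rewrite -(equivalence_partition_pblock (blocksP P)).
rewrite -(equivalence_partition_pblock (blocksP Q)).
by apply: eq_imset => x; apply/setP=> y; rewrite !inE; apply: eqPQ.
Qed.

Lemma same_blockxx P : reflexive (same_block P).
Proof. by move=> x; case: (same_block_equiv P x x x). Qed.

Lemma same_block_sym P : symmetric (same_block P).
Proof.
move=> x y; apply/idP/idP => h.
  by have [_ /(_ h) <-] := same_block_equiv P x y x; apply: same_blockxx.
by have [_ /(_ h) <-] := same_block_equiv P y x y; apply: same_blockxx.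
Qed.

Lemma same_block_trans P : transitive (same_block P).
Proof. by move=> y x z h1 h2; have [_ /(_ h1) ->] := same_block_equiv P x y z. Qed.

Definition refines P Q := [forall B in blocks P, exists C in blocks Q, B \subset C].

Lemma refinesP P Q :
  reflect (subrel (same_block P) (same_block Q)) (refines P Q).
Proof.
have covE (S : Part U) x : x \in cover S by rewrite (cover_partition (blocksP S)) inE.
have tiS (S : Part U) : trivIset S := partition_trivIset (blocksP S).
apply: (iffP forall_inP) => [le x y xy | le B PB].
  have /exists_inP[C QC sBC] := le _ (pblock_mem (covE P x)).
  rewrite /same_block (@def_pblock _ Q C x) //; last first.
    by apply: (subsetP sBC); rewrite mem_pblock.
  exact: (subsetP sBC).
have /set0Pn[x Bx] := partition_neq0 (blocksP P) PB.
apply/exists_inP; exists (pblock Q x); first exact: pblock_mem.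
apply/subsetP => y By; apply: le; rewrite /same_block.
by rewrite (def_pblock (tiS P) PB Bx).
Qed.

Lemma refines_refl : reflexive refines.
Proof. by move=> P; apply/refinesP. Qed.

Lemma refines_anti : antisymmetric refines.
Proof.
move=> P Q /andP[/refinesP PQ /refinesP QP]; apply: same_block_inj => x y.
by apply/idP/idP; [apply: PQ | apply: QP].
Qed.

Lemma refines_trans : transitive refines.
Proof.
by move=> Q P S /refinesP PQ /refinesP QS; apply/refinesP => x y /PQ /QS.
Qed.

Definition meet_rel P Q : rel U := fun x y => same_block P x y && same_block Q x y.

Lemma meet_rel_equiv P Q : equivalence_rel (meet_rel P Q).
Proof.
move=> x y z; rewrite /meet_rel !same_blockxx; split=> // /andP[h1 h2].
by have [_ /(_ h1) ->] := same_block_equiv P x y z;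
   have [_ /(_ h2) ->] := same_block_equiv Q x y z.
Qed.

Definition pmeet P Q := part_of_rel (@meet_rel_equiv P Q).

Definition join_rel P Q : rel U :=
  connect (fun x y => same_block P x y || same_block Q x y).

Lemma join_rel_equiv P Q : equivalence_rel (join_rel P Q).
Proof.
have sym : connect_sym (fun x y => same_block P x y || same_block Q x y).
  by apply: sym_connect_sym => x y; rewrite !(same_block_sym _ x y).
move=> x y z; split; first exact: connect0.
by move=> h; apply: (same_connect sym).
Qed.

Definition pjoin P Q := part_of_rel (@join_rel_equiv P Q).

Lemma pmeetP P Q S : refines P (pmeet Q S) = refines P Q && refines P S.
Proof.
apply/refinesP/andP => [h | [/refinesP h1 /refinesP h2] x y xy].
  by split; apply/refinesP => x y /h; rewrite same_block_part_of_rel => /andP[].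
by rewrite same_block_part_of_rel /meet_rel h1 ?h2.
Qed.

Lemma pjoinP P Q S : refines (pjoin P Q) S = refines P S && refines Q S.
Proof.
apply/refinesP/andP => [h | [/refinesP h1 /refinesP h2] x y].
  by split; apply/refinesP => x y xy; apply: h;
     rewrite same_block_part_of_rel; apply: connect1; rewrite xy ?orbT.
rewrite same_block_part_of_rel => /connectP[p + ->].
elim: p x => [|z p IHp] x /=; first by rewrite same_blockxx.
case/andP=> xz /IHp; apply: same_block_trans.
by case/orP: xz => [/h1|/h2].
Qed.

Lemma triangle_equiv : equivalence_rel (fun x y : U => x == y).
Proof. by move=> x y z; split=> // /eqP->. Qed.

Lemma nabla_equiv : equivalence_rel (fun _ _ : U => true).
Proof. by []. Qed.

Definition triangle := part_of_rel triangle_equiv.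
Definition nabla := part_of_rel nabla_equiv.

Lemma triangle_le P : refines triangle P.
Proof.
by apply/refinesP => x y; rewrite same_block_part_of_rel => /eqP->; apply: same_blockxx.
Qed.

Lemma nabla_ge P : refines P nabla.
Proof. by apply/refinesP => x y _; rewrite same_block_part_of_rel. Qed.

End PartitionLattice.

Fact refinement_display : Order.disp_t. Proof. exact: Order.Disp tt tt. Qed.

HB.instance Definition _ (U : finType) :=
  Order.Le_isPOrder.Build refinement_display (Part U)
    (@refines_refl U) (@refines_anti U) (@refines_trans U).
HB.instance Definition _ (U : finType) :=
  Order.POrder_MeetJoin_isLattice.Build refinement_display (Part U)
    (@pmeetP U) (@pjoinP U).
HB.instance Definition _ (U : finType) :=
  Order.hasBottom.Build refinement_display (Part U) (@triangle_le U).
HB.instance Definition _ (U : finType) :=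
  Order.hasTop.Build refinement_display (Part U) (@nabla_ge U).

Lemma part_leE (U : finType) (P Q : Part U) :
  (P <= Q) = [forall B in blocks P, exists C in blocks Q, B \subset C].
Proof. by []. Qed.

Lemma blocks_bot (U : finType) :
  blocks (\bot : Part U) = [set [set x] | x : U].
Proof.
rewrite /= /equivalence_partition; apply/setP => B.
apply/imsetP/imsetP => -[x _ ->]; exists x => //;
  by apply/setP => y; rewrite !inE eq_sym.
Qed.

(* Needs U nonempty: the partition of an empty U has no blocks. *)
Lemma blocks_top (U : finType) : (0 < #|U|)%N ->
  blocks (\top : Part U) = [set [set: U]].
Proof.
case/card_gt0P => x0 _; rewrite /= /equivalence_partition.
apply/setP => B; rewrite in_set1; apply/imsetP/eqP => [[x _ ->]|->].
  by apply/setP => y; rewrite !inE.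
by exists x0 => //; apply/setP => y; rewrite !inE.
Qed.

(* Boolean means complemented and distributive; the bounds o and i of B are its
   own, and B need not contain those of L. The one-element lattice is Boolean. *)
Record boolean_sublattice (d : Order.disp_t) (L : latticeType d) (B : {pred L}) :
    Prop := BooleanSublattice {
  bsl_meet : meet_closed B;
  bsl_join : join_closed B;
  bsl_distr : {in B & &, forall x y z, x `&` (y `|` z) = (x `&` y) `|` (x `&` z)};
  bsl_compl : exists o i : L,
    [/\ o \in B, i \in B, {in B, forall x, o <= x <= i}
      & {in B, forall x, exists2 y, y \in B & x `&` y = o /\ x `|` y = i}]
}.

(* Main.v *)
(** Choose one representative in each block of a partition [P] and let [c] be
    the partition whose only possibly nontrivial block is the set of chosen
    representatives; [c] is a complement of [P].  If [P] is the bottom of [B],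
    then [b |-> b `&` c] is a lattice embedding of [B], because every chain
    witnessing [b `|` b'] can be pushed onto the representatives.  If [P] is the
    top of [B], then [b |-> b `|` c] is a lattice embedding.  In both cases [B]
    together with the image of the embedding is a sublattice isomorphic to the
    product of [B] with the two-element lattice, hence Boolean; the first
    construction reaches the least partition, the second one the greatest. *)
Require Import Defs.
From mathcomp Require Import all_boot all_order.

Set Implicit Arguments.
Unset Strict Implicit.
Unset Printing Implicit Defensive.

Import Order.TTheory.
Local Open Scope order_scope.

(** * Images of the product with the two-element lattice *)

Section DoubledSublattice.
Variables (d : Order.disp_t) (T : finLatticeType d) (B : {set T}).
Variable f : T -> bool -> T.

Definition doubled : {set T} := [set f b e | b in B, e in [set: bool]].

Lemma doubled_mem b e : b \in B -> f b e \in doubled.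
Proof. by move=> Bb; apply: imset2_f; rewrite ?inE. Qed.

Hypothesis BB : boolean_sublattice B.
Hypothesis fI : {in B &, forall a b e e',
  f a e `&` f b e' = f (a `&` b) (e && e')}.
Hypothesis fU : {in B &, forall a b e e',
  f a e `|` f b e' = f (a `|` b) (e || e')}.

(** By [fI] and [fU], [f] is a homomorphism on the product of [B] with the two-element lattice, so
    distributivity, bounds and complements pass to its image. *)
Lemma boolean_doubled : boolean_sublattice doubled.
Proof.
case: BB => BI BU Bdistr [o [i [Bo Bi oi compl]]]; split.
- move=> _ _ /imset2P[a e Ba _ ->] /imset2P[b e' Bb _ ->].
  by rewrite fI //; apply: doubled_mem; apply: BI.
- move=> _ _ /imset2P[a e Ba _ ->] /imset2P[b e' Bb _ ->].
  by rewrite fU //; apply: doubled_mem; apply: BU.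
- move=> _ _ _ /imset2P[a e Ba _ ->] /imset2P[b e' Bb _ ->]
    /imset2P[c e'' Bc _ ->].
  by rewrite fU // !fI ?fU ?BI ?BU // Bdistr // andb_orr.
exists (f o false), (f i true); split; try exact: doubled_mem.
- move=> _ /imset2P[a e Ba _ ->]; have /andP[oa ai] := oi _ Ba.
  apply/andP; split; first by rewrite leEmeet fI // (meet_l oa).
  by rewrite leEmeet fI // (meet_l ai) andbT.
- move=> _ /imset2P[a e Ba _ ->]; have [a' Ba' [aIa' aUa']] := compl _ Ba.
  exists (f a' (~~ e)); first exact: doubled_mem.
  by rewrite fI // fU // aIa' aUa' andbN orbN.
Qed.

End DoubledSublattice.

(** * Block representatives and the partition that gathers them *)

Section BlockRepresentatives.
Variable U : finType.
Implicit Types (P Q b : Part U) (x y z : U).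

Lemma le_same_block P Q x y : P <= Q -> same_block P x y -> same_block Q x y.
Proof. by move=> /refinesP; apply. Qed.

Lemma same_blockI P Q x y :
  same_block (P `&` Q) x y = same_block P x y && same_block Q x y.
Proof. exact: same_block_part_of_rel. Qed.

(** The default is never reached, by reflexivity; hence the value depends only on the block of
    [x]. *)
Definition block_repr P x := odflt x [pick y | same_block P x y].

Lemma same_block_repr P x : same_block P x (block_repr P x).
Proof.
by rewrite /block_repr; case: pickP => //= _; apply: same_blockxx.
Qed.

Lemma block_repr_eq P x y :
  same_block P x y -> block_repr P x = block_repr P y.
Proof.
move=> xy; rewrite /block_repr; have -> : [pick z | same_block P x z] =
    [pick z | same_block P y z].
  by apply: eq_pick => z; have [_ /(_ xy) ->] := same_block_equiv P x y z.
by case: pickP => //= /(_ y); rewrite same_blockxx.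
Qed.

Lemma block_repr_id P x : block_repr P (block_repr P x) = block_repr P x.
Proof. by rewrite -(block_repr_eq (same_block_repr P x)). Qed.

(** Representatives are encoded as the fixed points of [block_repr P]. *)
Definition repr_rel P : rel U := fun x y =>
  (x == y) || (block_repr P x == x) && (block_repr P y == y).

Lemma repr_rel_equiv P : equivalence_rel (repr_rel P).
Proof.
move=> x y z; rewrite /repr_rel eqxx; split=> // /predU1P[-> //|].
case/andP=> rx ry; rewrite rx ry.
by case: (eqVneq x z) => [<-|_]; case: (eqVneq y) => [<-|_]; rewrite ?rx ?ry ?orbT.
Qed.

Definition repr_part P := part_of_rel (@repr_rel_equiv P).

Lemma repr_partE P x y : same_block (repr_part P) x y = repr_rel P x y.
Proof. exact: same_block_part_of_rel. Qed.

Lemma same_block_repr_part P x y :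
  same_block (repr_part P) (block_repr P x) (block_repr P y).
Proof. by rewrite repr_partE /repr_rel !block_repr_id !eqxx orbT. Qed.

Lemma meet_repr_part P : P `&` repr_part P = \bot.
Proof.
apply/eqP; rewrite -lex0; apply/refinesP => x y.
rewrite same_blockI repr_partE => /andP[/block_repr_eq xy].
rewrite same_block_part_of_rel => /predU1P[->//|/andP[/eqP<- /eqP<-]].
exact/eqP.
Qed.

Lemma same_block_repr_join P b x y : P <= b ->
  same_block b x y -> same_block b (block_repr P x) (block_repr P y).
Proof.
move=> Pb xy; have r z := le_same_block Pb (same_block_repr P z).
apply: same_block_trans (r y); apply: same_block_trans xy.
by rewrite same_block_sym.
Qed.

Lemma join_repr_part P b : P <= b -> (b `&` repr_part P) `|` P = b.
Proof.
move=> Pb; apply/eqP; rewrite eq_le leUx leIl Pb /=; apply/refinesP => x y xy.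
have r z : same_block ((b `&` repr_part P) `|` P) z (block_repr P z).
  exact: le_same_block (leUr _ _) (same_block_repr P z).
apply: same_block_trans (r x) _; rewrite same_block_sym.
apply: same_block_trans (r y) _; rewrite same_block_sym.
apply: le_same_block (leUl _ _) _.
by rewrite same_blockI same_block_repr_part same_block_repr_join.
Qed.

Lemma join_repr_part_top P : P `|` repr_part P = \top.
Proof.
apply/eqP; rewrite -le1x; apply/refinesP => x y _.
have r z : same_block (P `|` repr_part P) z (block_repr P z).
  exact: le_same_block (leUl _ _) (same_block_repr P z).
apply: same_block_trans (r x) _; rewrite same_block_sym.
apply: same_block_trans (r y) _.
exact: le_same_block (leUr _ _) (same_block_repr_part P y x).
Qed.

Lemma pullback_repr_equiv P Q :
  equivalence_rel (fun x y => same_block Q (block_repr P x) (block_repr P y)).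
Proof. by move=> x y z; apply: same_block_equiv. Qed.

Lemma meet_repr_part_join P b b' : P <= b -> P <= b' ->
  (b `&` repr_part P) `|` (b' `&` repr_part P) = (b `|` b') `&` repr_part P.
Proof.
move=> Pb Pb'; apply: le_anti; apply/andP; split.
  by rewrite leUx (leI2 (leUl _ _) (lexx _)) (leI2 (leUr _ _) (lexx _)).
set S := (b `&` _) `|` _.
(* Instead of handling chains, pull [S] back along [block_repr P]: the result bounds [b] and [b'],
   hence their join, and agrees with [S] on representatives. *)
pose Q := part_of_rel (pullback_repr_equiv P S).
have leQ a : P <= a -> a `&` repr_part P <= S -> a <= Q.
  move=> Pa aS; apply/refinesP => x y xy; rewrite same_block_part_of_rel.
  apply: le_same_block aS _.
  by rewrite same_blockI same_block_repr_part same_block_repr_join.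
have bbQ : b `|` b' <= Q.
  by rewrite leUx (leQ b Pb (leUl _ _)) (leQ b' Pb' (leUr _ _)).
apply/refinesP => x y; rewrite same_blockI repr_partE => /andP[/(le_same_block bbQ)].
rewrite same_block_part_of_rel => xy /predU1P[->|/andP[/eqP rx /eqP ry]].
  exact: same_blockxx.
by rewrite -rx -ry.
Qed.

(** For [b <= P] this is the join of [b] and [repr_part P] without chains: all blocks of [b] that
    contain a representative are fused into one. *)
Definition merge_rel P b : rel U := fun x y =>
  same_block b x y ||
  same_block b x (block_repr P x) && same_block b y (block_repr P y).

Lemma same_block_merge P b x y : b <= P -> same_block b x y ->
  same_block b x (block_repr P x) = same_block b y (block_repr P y).
Proof.
move=> bP xy; rewrite (block_repr_eq (le_same_block bP xy)).
by have [_ /(_ xy)] := same_block_equiv b x y (block_repr P y).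
Qed.

Lemma merge_rel_equiv P b : b <= P -> equivalence_rel (merge_rel P b).
Proof.
move=> bP x y z; rewrite /merge_rel same_blockxx; split=> // /orP[xy|/andP[rx ry]].
  have [_ /(_ xy) ->] := same_block_equiv b x y z.
  by rewrite (same_block_merge bP xy).
rewrite rx ry /=; case rz: (same_block b z _); first by rewrite !orbT.
rewrite !orbF; apply/idP/idP => /(same_block_merge bP).
  by rewrite rx rz.
by rewrite ry rz.
Qed.

Lemma same_block_join_repr_part P b x y : b <= P ->
  same_block (b `|` repr_part P) x y -> merge_rel P b x y.
Proof.
move=> bP; rewrite -(same_block_part_of_rel (merge_rel_equiv bP)).
apply: le_same_block; rewrite leUx; apply/andP; split; apply/refinesP => {}x {}y.
  by rewrite same_block_part_of_rel /merge_rel => ->.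
rewrite repr_partE same_block_part_of_rel /merge_rel.
case/predU1P=> [->|/andP[/eqP-> /eqP->]]; by rewrite !same_blockxx ?orbT.
Qed.

Lemma join_repr_part_meet P b b' : b <= P -> b' <= P ->
  (b `|` repr_part P) `&` (b' `|` repr_part P) = (b `&` b') `|` repr_part P.
Proof.
move=> bP b'P; apply: le_anti; apply/andP; split; last first.
  by rewrite lexI (leU2 (leIl _ _) (lexx _)) (leU2 (leIr _ _) (lexx _)).
apply/refinesP => x y; rewrite same_blockI => /andP[].
move=> /(same_block_join_repr_part bP) xy /(same_block_join_repr_part b'P) xy'.
have : merge_rel P (b `&` b') x y.
  rewrite /merge_rel !same_blockI.
  case/orP: xy => [xy|/andP[rx ry]]; case/orP: xy' => [xy'|/andP[rx' ry']].
  - by rewrite xy xy'.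
  (* In the mixed cases [x] and [y] share a block of [P], hence a representative, and being linked
     to it links them to each other. *)
  - have r : same_block P x y := le_same_block bP xy.
    rewrite xy (same_block_trans rx') //.
    by rewrite (block_repr_eq r) same_block_sym.
  - have r : same_block P x y := le_same_block b'P xy'.
    rewrite xy' (same_block_trans rx) //.
    by rewrite (block_repr_eq r) same_block_sym.
  - by rewrite rx ry rx' ry' orbT.
case/orP=> [|/andP[rx ry]]; first exact: le_same_block (leUl _ _).
apply: same_block_trans (le_same_block (leUl _ _) rx) _; rewrite same_block_sym.
apply: same_block_trans (le_same_block (leUl _ _) ry) _.
exact: le_same_block (leUr _ _) (same_block_repr_part P y x).
Qed.

(** A block of [P] has a single representative, so fusing blocks of [b] joins nothing new inside
    it. *)
Lemma meet_join_repr_part P b : b <= P -> (b `|` repr_part P) `&` P = b.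
Proof.
move=> bP; apply/eqP; rewrite eq_le lexI leUl bP !andbT; apply/refinesP => x y.
rewrite same_blockI => /andP[/(same_block_join_repr_part bP)/orP[//|]].
move=> /andP[rx ry] /block_repr_eq rxy.
by apply: same_block_trans rx _; rewrite rxy same_block_sym.
Qed.

End BlockRepresentatives.

(** * Adjoining the least and the greatest partition *)

Lemma boolean_extend_bot (U : finType) (B : {set Part U}) :
  boolean_sublattice B ->
  exists B' : {set Part U},
    [/\ boolean_sublattice B', B \subset B' & (\bot : Part U) \in B'].
Proof.
move=> BB; have [_ _ _ [o [i [Bo Bi oi _]]]] := BB.
have ge_o b : b \in B -> o <= b by case/oi/andP.
pose c := repr_part o.
pose f (b : Part U) e := if e then b else b `&` c.
(* This settles the joins with mixed flags: [b] absorbs [o], and joining [o] to the trace of [a] on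
   [c] restores [a]. *)
have joinE a b : a \in B -> b \in B -> (a `&` c) `|` b = a `|` b.
  move=> Ba Bb; rewrite -{1}(join_r (ge_o b Bb)) joinA.
  by rewrite join_repr_part ?ge_o.
exists (doubled B f); split.
- apply: boolean_doubled BB _ _ => a b Ba Bb [] [] //=.
  + by rewrite /f meetA.
  + by rewrite /f meetAC.
  + by rewrite /f meetACA meetxx.
  + by rewrite /f joinC joinE // joinC.
  + by rewrite /f joinE.
  + by rewrite /f meet_repr_part_join ?ge_o.
- by apply/subsetP => b; apply: (@doubled_mem _ _ _ f b true).
- by rewrite -(meet_repr_part o); apply: (@doubled_mem _ _ _ f o false).
Qed.

Lemma boolean_extend_top (U : finType) (B : {set Part U}) :
  boolean_sublattice B ->
  exists B' : {set Part U},
    [/\ boolean_sublattice B', B \subset B' & (\top : Part U) \in B'].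
Proof.
move=> BB; have [_ _ _ [o [i [Bo Bi oi _]]]] := BB.
have le_i b : b \in B -> b <= i by case/oi/andP.
pose c := repr_part i.
(* Here [true] marks the modified copy, since joining with [c] moves up; in the previous
   construction it marked the original. *)
pose f (b : Part U) e := if e then b `|` c else b.
have meetE a b : a \in B -> b \in B -> (a `|` c) `&` b = a `&` b.
  move=> Ba Bb; rewrite -{1}(meet_r (le_i b Bb)) meetA.
  by rewrite meet_join_repr_part ?le_i.
exists (doubled B f); split.
- apply: boolean_doubled BB _ _ => a b Ba Bb [] [] //=.
  + by rewrite /f join_repr_part_meet ?le_i.
  + by rewrite /f meetE.
  + by rewrite /f meetC meetE // meetC.
  + by rewrite /f joinACA joinxx.
  + by rewrite /f joinAC.
  + by rewrite /f joinA.
- by apply/subsetP => b; apply: (@doubled_mem _ _ _ f b false).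
- by rewrite -(join_repr_part_top i); apply: (@doubled_mem _ _ _ f i true).
Qed.

Theorem corollary2p3 (U : finType) (U_gt0 : (0 < #|U|)%N) (B : {set Part U})
    (BB : boolean_sublattice B) :
  exists Bs : {set Part U},
    [/\ boolean_sublattice Bs, B \subset Bs,
        (\bot%O : Part U) \in Bs & (\top%O : Part U) \in Bs].
Proof.
have [B1 [BB1 sBB1 bot1]] := boolean_extend_bot BB.
have [B2 [BB2 sB12 top2]] := boolean_extend_top BB1.
exists B2; split=> //; first exact: subset_trans sBB1 sB12.
exact: (subsetP sB12).
Qed.
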